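(* There exists a constant $C > 0$ such that for any sequence $(n_i)_{i \geq 0}$ of integers such that $n_0 \geq 2$ and $n_{i+1} \geq n_i^C$ for all $i \geq 0$, the set $E = \{ n_i \mid i \in \mathbb{N}_0 \}$ is generalised polynomial.
   Context: $\mathbb{N}_0=\{0,1,2,\dots\}$. The family of generalised polynomials (on $\mathbb{N}_0$) is the smallest set of functions $f\colon \mathbb{N}_0 \to \mathbb{R}$ which contains all polynomial maps (with real coefficients) and is closed under addition, multiplication, and the operation $f \mapsto \lfloor f \rfloor$ of taking the (pointwise) integer part. A set $E \subset \mathbb{N}_0$ is called generalised polynomial if its characteristic function $\mathbb{N}_0 \to \{0,1\}$ is a generalised polynomial. *)

(* Defs.v *)
From HB Require Import structures.
From mathcomp Require Import all_boot all_order all_algebra.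
From mathcomp Require Import all_classical all_reals all_analysis.

Set Implicit Arguments.
Unset Strict Implicit.
Unset Printing Implicit Defensive.

Import Order.TTheory GRing.Theory Num.Theory.

Local Open Scope classical_set_scope.
Local Open Scope ring_scope.

(* The least family closed under the stated operations; it respects pointwise
   equality thanks to functional extensionality. *)
Inductive genpoly (R : realType) : (nat -> R) -> Prop :=
| genpoly_poly (p : {poly R}) : genpoly (fun m => p.[m%:R])
| genpoly_add (f g : nat -> R) : genpoly f -> genpoly g -> genpoly (f \+ g)
| genpoly_mul (f g : nat -> R) : genpoly f -> genpoly g -> genpoly (f \* g)
| genpoly_floor (f : nat -> R) :
    genpoly f -> genpoly (fun m => (Num.floor (f m))%:~R).

Definition genpoly_set (R : realType) (E : set nat) : Prop :=
  genpoly (\1_E : nat -> R).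

(* Main.v *)
Require Import Defs.
From HB Require Import structures.
From mathcomp Require Import all_boot all_order all_algebra.
From mathcomp Require Import all_classical all_reals all_analysis.
From mathcomp Require Import ring lra zify.

Set Implicit Arguments.
Unset Strict Implicit.
Unset Printing Implicit Defensive.

Import Order.TTheory GRing.Theory Num.Theory.

Local Open Scope classical_set_scope.
Local Open Scope ring_scope.

(** Put [theta = sqrt 2]. Say that [a] hits [m] when the fractional part of
    [a * m + theta] is smaller than [m ^- 48]. For fixed [a], multiplying the
    fractional part by [m ^ 48] turns this into the condition that a
    generalised polynomial in [m] takes its value in [0, 1), and such
    conditions define generalised polynomial sets ([genpoly_set_unit_interval]).
    So it is enough to find, for a very sparse sequence [N], a real [a] whose
    hits, apart from small integers, are exactly the [N i]; the first term of
    the given sequence, which may be too small, is a singleton put in at the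
    end.

    For fixed [m], the reals that hit [m] form short intervals of length
    [m ^- 49] starting at the centres [(c - theta) / m], with [c] an integer.
    As [theta] is badly approximable, centres with denominators at most [M]
    are at least a constant times [M ^- 3] apart ([center_separated]). It is
    the shift by [theta] that makes this true even for multiples of the same
    integer, where the homogeneous fractions [c / m] would coincide.

    The number [a] comes from nested intervals. An interval of length [X ^- 7]
    meets at most one of the short intervals attached to the integers in
    [X, X ^ 2), so it can be shrunk to length [X ^- 14] so as to avoid hitting
    all of them ([avoid_block]); this returns to the same situation at the
    scale [X ^ 2]. When the next target [n] lies between [Z ^ 8] and [Z ^ 16],
    for the current scale [Z], the interval contains a centre with denominator
    [n]; shrinking to its right neighbourhood makes [n] hit, and separation
    forbids every other hit between [Z] and [n ^ 8] ([hit_target]). Alternating the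
    two moves handles gaps of any size ([next_hit], [hit_sequence]). *)

(** * The square root of two *)

(** The exponents of 2 in the two sides have different parities. *)
Lemma sqr_neq_double_sqr (p q : int) : q != 0 -> p ^+ 2 != 2 * q ^+ 2.
Proof.
move=> q0; apply/eqP => pq.
have h : (`|p| ^ 2 = 2 * `|q| ^ 2)%N by rewrite -!abszX pq abszM.
have q0' : (0 < `|q|)%N by rewrite absz_gt0.
have := congr1 (fun k => odd (logn 2 k)) h.
by rewrite lognM ?expn_gt0 ?q0' // !lognX oddD !oddM.
Qed.

Section SparseSets.
Variable R : realType.
Implicit Types (a : R) (m n X Z : nat) (c : int).

Let theta : R := Num.sqrt 2.

(** The product of [p + q * theta] with its conjugate [p - q * theta] is a
    nonzero integer, and the conjugate is at most [4 * |q|] when the first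
    factor is smaller than 1. *)
Lemma sqrt2_badly_approximable (p q : int) : q != 0 ->
  1 <= 4 * `|q%:~R| * `|p%:~R + q%:~R * theta|.
Proof.
move=> q0.
have q1 : 1 <= `|q%:~R : R|.
  by rewrite -intr_norm ler1z -gtz0_ge1 normr_gt0.
have t2 : theta ^+ 2 = 2 by rewrite sqr_sqrtr.
have t0 : 0 <= theta by exact: sqrtr_ge0.
have t32 : theta <= 3 / 2 by rewrite -(@ler_pXn2r _ 2) ?nnegrE // t2; lra.
have [big|small] := lerP 1 `|p%:~R + q%:~R * theta|; first by nra.
set u := p%:~R + q%:~R * theta in small *.
have uv : 1 <= `|u| * `|p%:~R - q%:~R * theta|.
  rewrite -normrM.
  have -> : u * (p%:~R - q%:~R * theta) = (p ^+ 2 - 2 * q ^+ 2)%:~R.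
    by rewrite intrB intrM !rmorphXn /= -[2%:~R]/(2 : R) -t2 /u; ring.
  by rewrite -intr_norm ler1z -gtz0_ge1 normr_gt0 subr_eq0 sqr_neq_double_sqr.
have : `|p%:~R - q%:~R * theta| <= `|u| + 2 * (`|q%:~R| * theta).
  have -> : p%:~R - q%:~R * theta = u - 2 * (q%:~R * theta) by rewrite /u; ring.
  apply: (le_trans (ler_normB _ _)).
  by rewrite !normrM (ger0_norm t0) normr_nat.
have := normr_ge0 u.
nra.
Qed.

(** * Generalised polynomial sets *)

Lemma genpoly_cst a : genpoly (fun=> a).
Proof.
by have := genpoly_poly a%:P; congr genpoly; apply/funext => m; rewrite hornerC.
Qed.

Lemma genpoly_natr : genpoly (fun m => m%:R : R).
Proof.
by have := genpoly_poly ('X : {poly R}); congr genpoly; apply/funext => m; rewrite hornerX.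
Qed.

Lemma genpoly_opp (f : nat -> R) : genpoly f -> genpoly (fun m => - f m).
Proof.
move=> /(genpoly_mul (genpoly_cst (-1))); congr genpoly.
by apply/funext => m /=; rewrite mulN1r.
Qed.

Lemma genpoly_exp (f : nat -> R) k : genpoly f -> genpoly (fun m => f m ^+ k).
Proof.
move=> gf; elim: k => [|k]; first exact: genpoly_cst.
move=> /(genpoly_mul gf); congr genpoly.
by apply/funext => m /=; rewrite exprS.
Qed.

(** With [z] the integer part of [f m], the sum of the integer parts of
    [theta * z] and of its opposite is [0] if [z = 0], and [-1] otherwise,
    because [theta * z] is then not an integer. *)
Lemma genpoly_set_unit_interval (f : nat -> R) :
  genpoly f -> genpoly_set R [set m | 0 <= f m < 1].
Proof.
move=> gf; rewrite /genpoly_set.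
have gfl := genpoly_floor gf.
have g1 := genpoly_floor (genpoly_mul (genpoly_cst theta) gfl).
have g2 := genpoly_floor (genpoly_opp (genpoly_mul (genpoly_cst theta) gfl)).
have := genpoly_add (genpoly_cst 1) (genpoly_add g1 g2).
congr genpoly; apply/funext => m /=; rewrite indicE.
set z := Num.floor (f m).
have zE : (m \in [set m | 0 <= f m < 1]) = (z == 0).
  by apply/idP/eqP => [|/eqP]; rewrite inE /=; [move=> /andP[? ?]; apply: floor_def; lra
    | rewrite floor_eq /=; lra].
rewrite zE; have [->|z0] := eqVneq z 0.
  by rewrite mulr0 oppr0 !floor0 !addr0.
have nint (p : int) : theta * z%:~R <> p%:~R.
  move=> h; have := sqrt2_badly_approximable (- p) z0.
  by rewrite mulrC in h *; rewrite h intrN addNr normr0 mulr0; lra.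
have -> : Num.floor (- (theta * z%:~R)) = - Num.floor (theta * z%:~R) - 1.
  apply: floor_def; have := floor_itv (theta * z%:~R) => /andP[h1 h2].
  have := nint (Num.floor (theta * z%:~R)) => h3.
  move: h1 h2; rewrite !(intrD, intrN, intrB) /= => h1 h2.
  apply/andP; split; lra.
by rewrite intrB intrN /=; lra.
Qed.

Lemma genpoly_setC (A : set nat) : genpoly_set R A -> genpoly_set R (~` A).
Proof.
move=> /genpoly_opp /(genpoly_add (genpoly_cst 1)); congr genpoly.
by apply/funext => m /=; rewrite !indicE in_setC; case: (m \in A); rewrite ?subrr ?subr0.
Qed.

Lemma genpoly_setI (A B : set nat) :
  genpoly_set R A -> genpoly_set R B -> genpoly_set R (A `&` B).
Proof.
move=> gA gB; have := genpoly_mul gA gB; congr genpoly.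
by apply/funext => m /=; rewrite !indicE in_setI -natrM mulnb.
Qed.

Lemma genpoly_setU (A B : set nat) :
  genpoly_set R A -> genpoly_set R B -> genpoly_set R (A `|` B).
Proof.
move=> /genpoly_setC gA /genpoly_setC gB.
by have := genpoly_setC (genpoly_setI gA gB); rewrite setCI !setCK.
Qed.

Lemma genpoly_set1 n : genpoly_set R [set n].
Proof.
have := genpoly_set_unit_interval (genpoly_exp 2 (genpoly_add genpoly_natr (genpoly_cst (- n%:R)))).
congr genpoly_set; apply/seteqP; split => m /=; last first.
  by move=> ->; rewrite subrr expr0n /= lexx ltr01.
move=> /andP[_]; rewrite -[m%:R - _]/((m%:Z)%:~R - (n%:Z)%:~R) -intrB -rmorphXn /= -[1]/(1%:~R) ltr_int => h.
by apply/eqP; rewrite -eqz_nat -subr_eq0; apply/eqP; nia.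
Qed.

Lemma genpoly_set_ge n : genpoly_set R [set m | (n <= m)%N].
Proof.
have [->|n0] := posnP n.
  by have := genpoly_cst 1; congr genpoly; apply/funext => m; rewrite indicE mem_set.
have := genpoly_setC (genpoly_set_unit_interval (genpoly_mul (genpoly_cst n%:R^-1) genpoly_natr)).
congr genpoly_set; apply/seteqP; split => m /=.
  move=> h; rewrite leqNgt; apply/negP => mn; apply: h.
  by rewrite mulr_ge0 //= mulrC ltr_pdivrMr ?ltr0n // mul1r ltr_nat.
by move=> nm; rewrite mulrC ltr_pdivrMr ?ltr0n // mul1r ltr_nat ltnNge nm andbF.
Qed.


(** * Hits and the separation of their centres *)

Definition center m c : R := (c%:~R - theta) / m%:R.

Definition hit a m :=
  exists c, center m c <= a < center m c + (m%:R ^+ 49)^-1.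

(** The only possible [c] is the integer part of [a * m + theta]; this turns the
    geometric form of a hit into the one seen by generalised polynomials. *)
Lemma hitP a m : (0 < m)%N ->
  let f := a * m%:R + theta in
  hit a m <-> 0 <= m%:R ^+ 48 * (f - (Num.floor f)%:~R) < 1.
Proof.
move=> m0 f.
have m1 : 1 <= m%:R :> R by rewrite ler1n.
have m48 : 1 <= m%:R ^+ 48 :> R by rewrite exprn_ege1.
have mu : m%:R * m%:R^-1 = 1 :> R by rewrite divff // gt_eqF //; lra.
have hitE c : (center m c <= a < center m c + (m%:R ^+ 49)^-1) =
    (0 <= m%:R ^+ 48 * (f - c%:~R) < 1).
  have -> : (center m c <= a) = (0 <= m%:R ^+ 48 * (f - c%:~R)).
    rewrite pmulr_rge0; last lra.
    rewrite ler_pdivrMr ?ltr0n // /f; apply/idP/idP; lra.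
  have -> : center m c + (m%:R ^+ 49)^-1 = (c%:~R - theta + (m%:R ^+ 48)^-1) / m%:R.
    by rewrite [X in (X)^-1]exprSr invfM /center -mulrDl.
  have -> : (m%:R ^+ 48 * (f - c%:~R) < 1) = (f - c%:~R < (m%:R ^+ 48)^-1).
    by rewrite -[(_ ^-1)]mul1r ltr_pdivlMr 1?mulrC //; lra.
  by rewrite ltr_pdivlMr ?ltr0n // /f; congr andb; apply/idP/idP; lra.
split=> [[c]|h]; last by exists (Num.floor f); rewrite hitE.
rewrite hitE => /[dup] h /andP[h1 h2].
suff -> : Num.floor f = c by [].
apply: floor_def; rewrite intrD; apply/andP; split; nra.
Qed.

(** After multiplication by [m * m'], the difference of two centres is
    [p + q * theta] with [p] an integer and [q = m - m'] of size at most [M];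
    when [q = 0], [p] is a nonzero integer. *)
Lemma center_separated m m' c c' M :
  (0 < m <= M)%N -> (0 < m' <= M)%N -> (m, c) != (m', c') ->
  1 <= 4 * (m%:R * m'%:R * M%:R) * `|center m c - center m' c'|.
Proof.
move=> /andP[m0 mM] /andP[m'0 m'M] ne.
have mR : 1 <= m%:R :> R by rewrite ler1n.
have m'R : 1 <= m'%:R :> R by rewrite ler1n.
have mMR : m%:R <= M%:R :> R by rewrite ler_nat.
have m'MR : m'%:R <= M%:R :> R by rewrite ler_nat.
have E : m%:R * m'%:R * `|center m c - center m' c'| =
    `|(c * m'%:Z - c' * m%:Z)%:~R + (m%:Z - m'%:Z)%:~R * theta|.
  rewrite -[X in X * `|_|]ger0_norm; last nra.
  rewrite -normrM; congr `|_|; rewrite !(intrD, intrM, intrN) /center /=.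
  rewrite -![(Posz _)%:~R]/(_%:R).
  by field; rewrite !gt_eqF //; lra.
have -> : 4 * (m%:R * m'%:R * M%:R) * `|center m c - center m' c'| =
  4 * M%:R * (m%:R * m'%:R * `|center m c - center m' c'|) by ring.
rewrite E.
have [mm'|mm'] := eqVneq m m'.
  have cc' : c - c' != 0.
    by apply: contraNneq ne => /eqP; rewrite subr_eq0 => /eqP ->; rewrite mm'.
  rewrite -mm' subrr mul0r addr0 -mulrBl.
  have : 1 <= `|((c - c') * m%:Z)%:~R| :> R.
    rewrite -intr_norm ler1z -gtz0_ge1 normr_gt0 mulf_neq0 //.
    by rewrite eqz_nat; lia.
  nra.
have q0 : m%:Z - m'%:Z != 0 by rewrite subr_eq0 eqz_nat.
have := sqrt2_badly_approximable (c * m'%:Z - c' * m%:Z) q0.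
set u := `|_ + _ * theta|.
have : `|(m%:Z - m'%:Z)%:~R| <= M%:R :> R.
  rewrite -intr_norm -[M%:R]/((Posz M)%:~R) ler_int; lia.
have : 0 <= u by exact: normr_ge0.
nra.
Qed.

(** * Nested intervals *)

(** If the leftmost piece of length [X ^- 14] meets some hitting interval, the
    piece starting at the midpoint meets none: by separation it could only meet
    that same interval, which is too short to reach the midpoint. *)
Lemma avoid_block X a : (16 <= X)%N ->
  exists a', [/\ a <= a', a' + X%:R^-1 ^+ 14 <= a + X%:R^-1 ^+ 7 &
    forall b m, a' <= b <= a' + X%:R^-1 ^+ 14 -> (X <= m < X ^ 2)%N -> ~ hit b m].
Proof.
move=> X16.
have cond k : (X <= k < X ^ 2)%N -> (0 < k <= X ^ 2)%N.
  by move=> /andP[Xk /ltnW ->]; rewrite andbT; apply: leq_trans Xk; lia.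
have X0 k : (X <= k)%N -> (0 < k)%N by apply: leq_trans; lia.
have XR : 16 <= X%:R :> R by rewrite (ler_nat _ 16).
set e := X%:R^-1.
have eX : e * X%:R = 1 by rewrite /e mulVf // gt_eqF //; lra.
have e0 : 0 < e by rewrite invr_gt0; lra.
have e16 : e <= 16^-1 by rewrite lef_pV2 ?posrE //; lra.
have e6 : 0 < e ^+ 6 by rewrite exprn_gt0.
have e7 : e ^+ 7 <= e ^+ 6 / 16 by rewrite [e ^+ 7]exprSr ler_pM2l.
have e70 : 0 < e ^+ 7 by rewrite exprn_gt0.
have e8 : e ^+ 8 <= e ^+ 7 / 16 by rewrite [e ^+ 8]exprSr ler_pM2l.
have e14 : e ^+ 14 <= e ^+ 8 by rewrite ler_wiXn2l //; lra.
have e140 : 0 < e ^+ 14 by rewrite exprn_gt0.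
have e49 : e ^+ 49 <= e ^+ 8 by rewrite ler_wiXn2l //; lra.
have bad m : (X <= m)%N -> (m%:R ^+ 49)^-1 <= e ^+ 49.
  move=> Xm; rewrite -exprVn lerXn2r // ?nnegrE ?invr_ge0 ?ler0n //.
  by rewrite lef_pV2 ?posrE ?ler_nat ?ltr0n ?X0.
have [[b1 [m1 [b1a Xm1 [c1 h1]]]]|no] := pselect (exists b m,
    [/\ a <= b <= a + e ^+ 14, (X <= m < X ^ 2)%N & hit b m]); last first.
  exists a; split=> //; first lra.
  by move=> b m ab Xm hb; apply: no; exists b, m.
exists (a + e ^+ 7 / 2); split; [lra..|] => b2 m2 b2a Xm2 [c2 h2].
have [/andP[Xm1l Xm1r] /andP[Xm2l Xm2r]] := (Xm1, Xm2).
have [[mE cE]|ne] := eqVneq (m1, c1) (m2, c2).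
  by have := bad _ Xm2l; rewrite -mE -cE in h2 *; lra.
have := @center_separated m1 m2 c1 c2 (X ^ 2) _ _ ne.
set d := `|_|; have d0 : 0 <= d by exact: normr_ge0.
have dub : d <= e ^+ 7 + e ^+ 49.
  by have := bad _ Xm1l; have := bad _ Xm2l; rewrite ler_norml; lra.
have le6 : m1%:R * m2%:R * (X ^ 2)%:R * e ^+ 6 <= 1.
  have E : (X ^ 2 * X ^ 2 * X ^ 2)%:R * e ^+ 6 = 1.
    transitivity ((e * X%:R) ^+ 6); last by rewrite eX expr1n.
    by rewrite !natrM; ring.
  rewrite -[leRHS]E -!natrM ler_pM2r // ler_nat leq_mul2r leq_mul ?orbT //; exact: ltnW.
move=> /(_ (cond _ Xm1) (cond _ Xm2)) sep.
set M := m1%:R * m2%:R * (X ^ 2)%:R in le6 sep.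
have M0 : 0 <= M by rewrite !mulr_ge0.
nra.
Qed.

(** The separation bound for unequal denominators, in the form used around a
    target: the longer hitting interval, attached to [p], does not reach from
    one centre to the other. *)
Lemma center_gap p q c c' : (0 < p < q)%N -> (16 * q ^ 2 <= p ^ 48)%N ->
  (p%:R ^+ 49)^-1 < `|center p c - center q c'|.
Proof.
move=> /andP[p0 pq] qp.
have ne : (p, c) != (q, c') by apply/eqP => -[e]; rewrite e ltnn in pq.
have p0q : (0 < p <= q)%N by rewrite p0 ltnW.
have q0q : (0 < q <= q)%N by rewrite leqnn andbT (ltn_trans p0).
have := center_separated p0q q0q ne.
set d := `|_| => sep; have p49 : 0 < p%:R ^+ 49 :> R by rewrite exprn_gt0 ?ltr0n.
rewrite -[X in X < _]mul1r ltr_pdivrMr //.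
have qpR : 16 * q%:R ^+ 2 <= p%:R ^+ 48 :> R by rewrite -!natrX -natrM ler_nat.
have pR : 0 < p%:R :> R by rewrite ltr0n.
have d0 : 0 <= d by exact: normr_ge0.
rewrite (exprSr _ 48).
have : 16 * q%:R ^+ 2 * (p%:R * d) <= p%:R ^+ 48 * (p%:R * d).
  by rewrite ler_wpM2r // mulr_ge0 // ltW.
have -> : d * (p%:R ^+ 48 * p%:R) = p%:R ^+ 48 * (p%:R * d) by ring.
move: sep; have -> : 4 * (p%:R * q%:R * q%:R) * d = 4 * (q%:R ^+ 2 * (p%:R * d)).
  by ring.
rewrite -[16 * _ * _]mulrA; set u := _ ^+ 2 * _; set v := _ ^+ 48 * _; lra.
Qed.

(** A spacing [1 / n <= Z ^- 8] of the centres with denominator [n] guarantees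
    one of them, [x], in the left half of the interval. If [b] just to the right
    of [x] hits [m], then [x] and a centre for [m] lie within the length of the
    longer of the two hitting intervals, which [center_gap] forbids: for [m < n]
    because [n < Z ^ 16] gives [n ^ 3 <= m ^ 48], and for [m > n] because
    [m < n ^ 8] gives [m ^ 2 <= n ^ 16]. *)
Lemma hit_target Z a n : (16 <= Z)%N -> (Z ^ 8 <= n < Z ^ 16)%N ->
  exists a', [/\ a <= a', a' + n%:R^-1 ^+ 56 <= a + Z%:R^-1 ^+ 7 &
    forall b, a' <= b <= a' + n%:R^-1 ^+ 56 ->
      hit b n /\ forall m, (Z <= m < n ^ 8)%N -> m != n -> ~ hit b m].
Proof.
move=> Z16 /andP[Zn nZ].
have Z0 : (0 < Z)%N by apply: leq_trans Z16.
have n16 : (16 <= n)%N.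
  by apply: leq_trans Zn; apply: (leq_trans Z16); rewrite -[X in (X <= _)%N]expn1 leq_pexp2l.
have gap_lt m : (Z <= m)%N -> (16 * n ^ 2 <= m ^ 48)%N.
  move=> Zm; apply: (@leq_trans (n ^ 3)); first by rewrite (expnS n 2) leq_mul2r n16 orbT.
  apply: (@leq_trans ((Z ^ 16) ^ 3)); first by rewrite leq_exp2r // ltnW.
  by rewrite -expnM leq_exp2r.
have gap_gt m : (m < n ^ 8)%N -> (16 * m ^ 2 <= n ^ 48)%N.
  move=> mn; apply: (@leq_trans (n * (n ^ 8) ^ 2)).
    by rewrite leq_mul // leq_exp2r // ltnW.
  by rewrite -expnM -expnS leq_pexp2l // (leq_trans _ n16).
have n0 : (0 < n)%N by apply: leq_trans n16.
have ZR : 16 <= Z%:R :> R by rewrite (ler_nat _ 16).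
have nR : 16 <= n%:R :> R by rewrite (ler_nat _ 16).
set e := Z%:R^-1; set d := n%:R^-1.
have e0 : 0 < e by rewrite invr_gt0; lra.
have e16 : e <= 16^-1 by rewrite lef_pV2 ?posrE //; lra.
have d0 : 0 < d by rewrite invr_gt0; lra.
have d16 : d <= 16^-1 by rewrite lef_pV2 ?posrE //; lra.
have de : d <= e ^+ 8.
  by rewrite exprVn lef_pV2 ?posrE ?exprn_gt0 ?ltr0n // -natrX ler_nat.
have e70 : 0 < e ^+ 7 by rewrite exprn_gt0.
have e8 : e ^+ 8 <= e ^+ 7 / 16 by rewrite [e ^+ 8]exprSr ler_pM2l.
have d50 : d ^+ 50 <= d ^+ 1 by rewrite ler_wiXn2l //; lra.
have d490 : 0 < d ^+ 49 by rewrite exprn_gt0.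
have d50' : d ^+ 50 <= d ^+ 49 / 16 by rewrite [d ^+ 50]exprSr ler_pM2l.
have d56 : d ^+ 56 <= d ^+ 50 by rewrite ler_wiXn2l //; lra.
rewrite expr1 in d50.
have dE : (n%:R ^+ 49)^-1 = d ^+ 49 by rewrite exprVn.
pose c := Num.ceil (a * n%:R + theta).
have ax : a <= center n c.
  have := ceil_ge (a * n%:R + theta); rewrite -/c => h.
  rewrite /center ler_pdivlMr ?ltr0n //; lra.
have xa : center n c <= a + d.
  have := ceilB1_lt (a * n%:R + theta); rewrite -/c intrB => h.
  rewrite /center ler_pdivrMr ?ltr0n // mulrDl mulVf; last by rewrite gt_eqF //; lra.
  lra.
exists (center n c); split; [exact: ax|lra|] => b xb.
split; first by exists c; rewrite dE; lra.
move=> m /andP[Zm mn] ne [c' h'].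
have m0 : (0 < m)%N by apply: leq_trans Zm.
have [mn'|nm] : (m < n)%N \/ (n < m)%N by apply/orP; rewrite -neq_ltn.
- have := @center_gap m n c' c; rewrite m0 mn' gap_lt // => /(_ isT isT).
  have md : d ^+ 49 <= (m%:R ^+ 49)^-1.
    by rewrite -dE lef_pV2 ?posrE ?exprn_gt0 ?ltr0n // lerXn2r ?nnegrE // ler_nat ltnW.
  rewrite ltNge => /negP; apply; rewrite ler_norml; lra.
- have := @center_gap n m c c'; rewrite n0 nm gap_gt // => /(_ isT isT).
  have md : (m%:R ^+ 49)^-1 <= d ^+ 49.
    by rewrite -dE lef_pV2 ?posrE ?exprn_gt0 ?ltr0n // lerXn2r ?nnegrE // ler_nat ltnW.
  rewrite ltNge dE => /negP; apply; rewrite ler_norml; lra.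
Qed.

(** The scale is squared until [n] falls below its sixteenth power; the
    hypothesis [Z ^ 8 <= n] survives a squaring exactly when [Z ^ 16 <= n]. *)
Lemma next_hit Z a n : (16 <= Z)%N -> (Z ^ 8 <= n)%N ->
  exists a', [/\ a <= a', a' + n%:R^-1 ^+ 56 <= a + Z%:R^-1 ^+ 7 &
    forall b, a' <= b <= a' + n%:R^-1 ^+ 56 ->
      hit b n /\ forall m, (Z <= m < n ^ 8)%N -> m != n -> ~ hit b m].
Proof.
have [k] := ubnP (n - Z)%N; elim: k Z a => // k IH Z a nZk Z16 Zn.
have [nZ|Zn16] := ltnP n (Z ^ 16); first by apply: hit_target => //; rewrite Zn.
have Z1 : (1 < Z)%N by apply: leq_trans Z16.
have ZZ2 : (Z < Z ^ 2)%N by rewrite -[X in (X < _)%N]expn1 ltn_exp2l.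
have Z2n : (Z ^ 2 < n)%N by apply: leq_trans Zn16; rewrite ltn_exp2l.
have [a1 [aa1 a1a no1]] := avoid_block a Z16.
have [] := IH (Z ^ 2)%N a1.
- have lt : (n - Z ^ 2 < n - Z)%N by rewrite ltn_sub2l // (ltn_trans ZZ2).
  exact: leq_trans lt nZk.
- exact: leq_trans Z16 (ltnW ZZ2).
- by rewrite -expnM.
move=> a2 [a12 a21 h2].
have E : (Z ^ 2)%:R^-1 ^+ 7 = Z%:R^-1 ^+ 14 :> R.
  by rewrite !exprVn natrX -exprM.
rewrite E in a21.
exists a2; split; [lra..|] => b a2b.
have [hbn no2] := h2 b a2b; split=> // m /andP[Zm mn] ne.
have [mZ|Zm'] := ltnP m (Z ^ 2); last by apply: no2 => //; rewrite Zm' mn.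
by apply: no1; [lra|rewrite Zm mZ].
Qed.

Lemma sparse_ge16 (N : nat -> nat) :
  (16 ^ 8 <= N 0)%N -> (forall i, N i ^ 64 <= N i.+1)%N ->
  forall i, (16 <= N i)%N.
Proof.
move=> N0 Nexp; elim=> [|i IH].
  by apply: leq_trans N0; rewrite -[X in (X <= _)%N]expn1 leq_pexp2l.
apply: leq_trans (Nexp i); apply: (leq_trans IH).
by rewrite -[X in (X <= _)%N]expn1 leq_pexp2l // (leq_trans _ IH).
Qed.

(** The interval reached after the target [N i] has length [N i ^- 56], which is
    the seventh power of the inverse of [N i ^ 8], so it is a legitimate start
    for a search from the scale [N i ^ 8]; since [(N i ^ 8) ^ 8 = N i ^ 64], the
    growth hypothesis lets that search aim at [N i.+1]. The number wanted is
    the common point of the nested intervals, and the blocks of integers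
    between consecutive scales cover everything from 16 on. *)
Lemma hit_sequence (N : nat -> nat) :
  (16 ^ 8 <= N 0)%N -> (forall i, N i ^ 64 <= N i.+1)%N ->
  exists a, (forall i, hit a (N i)) /\
    forall m, (16 <= m)%N -> hit a m -> exists i, N i = m.
Proof.
move=> N0 Nexp.
(* [Z i] is the scale from which the search for the target [N i] starts. *)
pose Z i := (if i is j.+1 then N j ^ 8 else 16)%N.
have N16 := sparse_ge16 N0 Nexp.
have Ngt0 i : (0 < N i)%N by apply: leq_trans (N16 i).
have Z16 i : (16 <= Z i)%N.
  case: i => [|i] //=; apply: (leq_trans (N16 i)).
  by rewrite -[X in (X <= _)%N]expn1 leq_pexp2l.
have ZN i : (Z i ^ 8 <= N i)%N by case: i => [|i] //=; rewrite -expnM.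
have Ni i : (i < N i)%N.
  elim: i => [|i IH] //; apply: leq_trans (Nexp i).
  apply: leq_ltn_trans IH _.
  by rewrite -[X in (X < _)%N]expn1 ltn_exp2l // (leq_trans _ (N16 i)).
have [f fP] := choice (fun ia : nat * R => next_hit ia.2 (Z16 ia.1) (ZN ia.1)).
pose A := fix A i : R := if i is j.+1 then f (j, A j) else 0.
pose B i : R := A i + (Z i)%:R^-1 ^+ 7.
have BE i : B i.+1 = A i.+1 + (N i)%:R^-1 ^+ 56.
  by rewrite /B /= !exprVn natrX -exprM.
have AB i : A i <= B i by rewrite lerDl exprn_ge0 // invr_ge0.
have Ahomo : {homo A : i j / (i <= j)%N >-> i <= j}.
  by apply/nondecreasing_seqP => i; have [] := fP (i, A i).
have Bhomo : {homo B : i j / (i <= j)%N >-> j <= i}.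
  by apply/nonincreasing_seqP => i; rewrite BE; have [] := fP (i, A i).
have AB' i j : A i <= B j.
  apply: (le_trans (Ahomo _ _ (leq_maxl i j))); apply: (le_trans (AB _)).
  by apply: Bhomo; exact: leq_maxr.
pose a := sup (range A).
have aP i : A i.+1 <= a <= A i.+1 + (N i)%:R^-1 ^+ 56.
  rewrite -BE; apply/andP; split.
    by apply: ub_le_sup; [exists (B 0%N) => _ [k _ <-] | exists i.+1].
  by apply: ge_sup; [exists (A 0%N), 0%N | move=> _ [k _ <-]].
have hitP i : hit a (N i) /\
    forall m, (Z i <= m < N i ^ 8)%N -> m != N i -> ~ hit a m.
  by have [_ _] := fP (i, A i); apply; exact: aP.
exists a; split=> [i|m m16 ham]; first by case: (hitP i).
have exZ : exists i, (m < Z i)%N.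
  exists m.+1 => /=; apply: (leq_trans (Ni m)).
  by rewrite -[X in (X <= _)%N]expn1 leq_pexp2l.
case: (ex_minnP exZ) => -[|i] mZ minZ; first by move: mZ; rewrite ltnNge m16.
exists i; apply/eqP; rewrite eq_sym; apply/negPn/negP => ne.
have [_ /(_ m)] := hitP i; apply=> //.
rewrite [X in _ && X]mZ andbT leqNgt; apply/negP => /minZ.
by rewrite ltnn.
Qed.

(** * From hits to generalised polynomial sets *)

Lemma genpoly_set_hit a : genpoly_set R [set m | (0 < m)%N /\ hit a m].
Proof.
pose f m := a * m%:R + theta.
have gf : genpoly f.
  exact: genpoly_add (genpoly_mul (genpoly_cst a) genpoly_natr) (genpoly_cst theta).
have gh := genpoly_mul (genpoly_exp 48 genpoly_natr)
  (genpoly_add gf (genpoly_opp (genpoly_floor gf))).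
have := genpoly_setI (genpoly_set_ge 1) (genpoly_set_unit_interval gh).
by congr genpoly_set; apply/seteqP; split => m /= [m0 h]; split=> //; apply/(hitP a m0).
Qed.

Lemma genpoly_set_sparse (N : nat -> nat) :
  (16 ^ 8 <= N 0)%N -> (forall i, N i ^ 64 <= N i.+1)%N ->
  genpoly_set R [set m | exists i, N i = m].
Proof.
move=> N0 Nexp; have [a [hN Nh]] := hit_sequence N0 Nexp.
have N16 := sparse_ge16 N0 Nexp.
have := genpoly_setI (genpoly_set_ge 16) (genpoly_set_hit a).
congr genpoly_set; apply/seteqP; split => m /=.
  by move=> [m16 [_ ham]]; exact: Nh.
by move=> [i <-]; do !split=> //; apply: leq_trans (N16 i).
Qed.

End SparseSets.

Theorem theoremC (R : realType) :
  exists C : R, 0 < C /\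
    forall n : nat -> int,
      2 <= n 0%N ->
      (forall i : nat, (n i)%:~R `^ C <= (n i.+1)%:~R) ->
      genpoly_set R [set m : nat | exists i : nat, n i = m%:Z].
Proof.
exists 64%:R; split=> [|n n0 nexp]; first by rewrite ltr0n.
have nX i : 2 <= n i -> n i ^+ 64 <= n i.+1.
  move=> n2; have := nexp i; rewrite powR_mulrn ?ler0z; last exact: le_trans n2.
  by rewrite -rmorphXn /= ler_int.
have n2 i : 2 <= n i.
  elim: i => // i IH; apply: le_trans (nX i IH); apply: (le_trans IH).
  by rewrite ler_eXnr // (le_trans _ IH).
have nE i : n i = `|n i|%N by rewrite gez0_abs // (le_trans _ (n2 i)).
have NX i : (`|n i| ^ 64 <= `|n i.+1|)%N.
  by rewrite -lez_nat -nE -abszX gez0_abs ?nX // exprn_ge0 // (le_trans _ (n2 i)).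
have N2 : (2 <= `|n 0|)%N by rewrite -lez_nat -nE.
(* The term of index 1 is already at least [2 ^ 64]. *)
have big : (16 ^ 8 <= `|n 1|)%N.
  apply: leq_trans (NX 0%N); rewrite -[16%N]/(2 ^ 4)%N -expnM.
  by apply: (@leq_trans (2 ^ 64)); [rewrite leq_exp2l | rewrite leq_exp2r].
have := genpoly_setU (genpoly_set1 R `|n 0|)
  (genpoly_set_sparse R (N := fun i => `|n i.+1|%N) big (fun i => NX i.+1)).
congr genpoly_set; apply/seteqP; split => m /=.
  by move=> [->|[i <-]]; [exists 0%N | exists i.+1].
move=> [[|i] nm]; [left | right; exists i]; by rewrite nm.
Qed.
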